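(* For all positive integers $M$ and $s^{(1)},\dots,s^{(M)}$ there exist positive constants $C_{14},C_{15}$ depending only on $s^{(1)},\dots,s^{(M)}$, and for each $j\in\{1,\dots,M\}$ and each $\tau^{(j)}>0$ there exists a constant $C_{16}(s^{(j)},\tau^{(j)})$ depending only on $s^{(j)}$ and $\tau^{(j)}$, such that the following holds. Suppose that the node set $\mathcal{X}=\{x_1,\dots,x_s\}\subset(-\pi,\pi]$ (with $s=\sum_j s^{(j)}$) forms an $((h^{(j)},\tau^{(j)},s^{(j)})_{j=1}^M,\theta)$-clustered configuration, with clusters $\mathcal{C}^{(1)},\dots,\mathcal{C}^{(M)}$, and put $h=\max_{1\le j\le M}h^{(j)}$. Let the integer $N>s$ satisfy $\frac{C_{14}}{\theta}\le N\le\frac{C_{15}}{h}$. Let $\mathbf{a}_0\in\mathbb{C}^s$ be arbitrary, let $\mathbf{b}_0=\mathbf{V}_N(\mathcal{X})\mathbf{a}_0$, and let $\mathbf{b}\in\mathbb{C}^{N+1}$. Then for each $j\in\{1,\dots,M\}$ and all indices $\ell$ with $x_\ell\in\mathcal{C}^{(j)}$ we have $$\Bigl|\bigl(\mathbf{a}(\mathcal{X},\mathbf{b})-\mathbf{a}_0\bigr)_\ell\Bigr|\ \le\ C_{16}(s^{(j)},\tau^{(j)})\; s\left(\frac{1}{Nh^{(j)}}\right)^{s^{(j)}-1}\|\mathbf{b}-\mathbf{b}_0\|_\infty,$$ where $\mathbf{a}(\mathcal{X},\mathbf{b}):=\arg\min_{\mathbf{a}\in\mathbb{C}^s}\|\mathbf{V}_N(\mathcal{X})\mathbf{a}-\mathbf{b}\|_2$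 is the least squares solution.
   Context: Wrap-around distance: for $x,y\in\mathbb{R}$, $\Delta(x,y)=|\operatorname{Arg}(e^{\imath(x-y)})|\in[0,\pi]$, where $\operatorname{Arg}$ is the principal argument with values in $(-\pi,\pi]$. Cluster: for $h,\tau>0$, a set of $s$ distinct nodes in $(-\pi,\pi]$ forms an $(h,\tau,s)$-cluster if $\tau h\le\Delta(x,y)\le h$ for all distinct $x,y$ in the set. Clustered configuration: $\mathcal{X}=\{x_1,\dots,x_s\}\subset(-\pi,\pi]$ forms an $((h^{(j)},\tau^{(j)},s^{(j)})_{j=1}^M,\theta)$-clustered configuration if there is a partition $\mathcal{X}=\biguplus_{j=1}^M\mathcal{C}^{(j)}$ such that for each $j$: $\mathcal{C}^{(j)}$ is an $(h^{(j)},\tau^{(j)},s^{(j)})$-cluster, and $\Delta(x,y)\ge\theta>0$ for all $x\in\mathcal{C}^{(j)}$, $y\in\mathcal{X}\setminus\mathcal{C}^{(j)}$. $\mathbf{V}_N(\mathcal{X})$ is the $(N+1)\times s$ Vandermonde matrix with entries $e^{\imath k x_j}$ ($k=0,\dots,N$, $j=1,\dots,s$); it has full column rank, so the least squares solution is unique. $(\mathbf{v})_\ell$ denotes the $\ell$-th component of a vector $\mathbf{v}$. *)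

(* Defs.v *)
From HB Require Import structures.
From mathcomp Require Import all_boot all_order all_algebra.
From mathcomp Require Import all_classical all_reals all_analysis.
From mathcomp Require Import complex.

Set Implicit Arguments.
Unset Strict Implicit.
Unset Printing Implicit Defensive.

Import Order.TTheory GRing.Theory Num.Theory.

Local Open Scope classical_set_scope.
Local Open Scope ring_scope.
Local Open Scope complex_scope.
Local Open Scope card_scope.

(* The complex modulus as an element of R; the generic norm `|z| of MathComp
   has values in R[i]. *)
Definition cmod (R : realType) (z : R[i]) : R := Normc.normc z.

(* e^(i t) *)
Definition expi (R : realType) (t : R) : R[i] := cos t +i* sin t.

(* The set is a singleton for z <> 0; the value at 0 is irrelevant. *)
Definition Arg (R : realType) (z : R[i]) : R :=
  xget 0 [set t : R | - pi < t <= pi /\ z = (cmod z)%:C * expi t].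

Definition wrap_dist (R : realType) (x y : R) : R := `|Arg (expi (x - y))|.

Definition is_cluster (R : realType) (h tau : R) (s : nat) (C : set R) : Prop :=
  [/\ 0 < h, 0 < tau,
      C `<=` [set x | - pi < x <= pi],
      C #= `I_s
    & forall x y, C x -> C y -> x <> y -> tau * h <= wrap_dist x y <= h].

(* [C] is a partition of the node set [X] witnessing that [X] forms an
   ((h j, tau j, s j)_j, theta)-clustered configuration. *)
Definition clustered_configuration (R : realType) (M : nat)
    (h tau : 'I_M -> R) (s : 'I_M -> nat) (theta : R)
    (X : set R) (C : 'I_M -> set R) : Prop :=
  [/\ 0 < theta,
      X `<=` [set x | - pi < x <= pi],
      \bigcup_j C j = X /\ trivIset setT C,
      forall j, is_cluster (h j) (tau j) (s j) (C j)
    & forall j x y, C j x -> (X `\` C j) y -> theta <= wrap_dist x y].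

Definition vandermonde (R : realType) (N n : nat) (x : 'I_n -> R) :
    'M[R[i]]_(N.+1, n) :=
  \matrix_(k < N.+1, j < n) expi (k%:R * x j).

Definition norm2 (R : realType) (m : nat) (v : 'cV[R[i]]_m) : R :=
  Num.sqrt (\sum_(k < m) cmod (v k 0) ^+ 2).

Definition norm_infty (R : realType) (m : nat) (v : 'cV[R[i]]_m) : R :=
  \big[Num.max/0]_(k < m) cmod (v k 0).

Definition is_least_squares (R : realType) (m n : nat) (V : 'M[R[i]]_(m, n))
    (b : 'cV[R[i]]_m) (a : 'cV[R[i]]_n) : Prop :=
  forall a' : 'cV[R[i]]_n, norm2 (V *m a - b) <= norm2 (V *m a' - b).

(* The minimizer always exists, and is unique when V has full column rank, so
   the default value 0 of xget is never taken. *)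
Definition least_squares (R : realType) (m n : nat) (V : 'M[R[i]]_(m, n))
    (b : 'cV[R[i]]_m) : 'cV[R[i]]_n :=
  xget 0 [set a | is_least_squares V b a].

(* Main.v *)
Require Import Defs.
From HB Require Import structures.
From mathcomp Require Import all_boot all_order all_algebra.
From mathcomp Require Import all_classical all_reals all_analysis.
From mathcomp Require Import complex.
From mathcomp Require Import zify lra ring.

(* Each component l of the error equals u . V (a - a0) for any dual vector u, i.e.
   any polynomial P of degree at most N with P(e^{i x_k}) = delta_{kl}; and
   ||V (a - a0)||_2 <= 2 ||b - b0||_2 because a is a minimizer.  So a P with small
   coefficients suffices.  It is the product of a Dirichlet kernel centred at x_l
   (coefficient norm of order N^{-1/2}), of one factor (w^m - y^m) / (x_l^m - y^m) of
   size O(1/(N tau h)) with m = N/s_j for every other node y of the cluster, and, for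
   every node of another cluster, of one minus a Fejer kernel centred at that node.
   The latter takes values in [0,1] in modulus and is almost 1 at x_l when N theta is
   large, so all these factors together cost at most a factor 2, whatever their
   number.  Discrete Parseval converts the sup bounds into coefficient bounds. *)

Set Implicit Arguments.
Unset Strict Implicit.
Unset Printing Implicit Defensive.

Import Order.TTheory GRing.Theory Num.Theory.
Import numFieldNormedType.Exports.

Local Open Scope classical_set_scope.
Local Open Scope ring_scope.
Local Open Scope complex_scope.

(** * The real-valued complex modulus *)

Section Modulus.
Variable R : realType.
Implicit Types z w : R[i].

Lemma cmodM z w : cmod (z * w) = cmod z * cmod w.
Proof. exact: Normc.normcM. Qed.

Lemma cmod_ge0 z : 0 <= cmod z.
Proof. by case: z => a b; rewrite /cmod /= sqrtr_ge0. Qed.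

Lemma cmodD z w : cmod (z + w) <= cmod z + cmod w.
Proof. exact: le_normcD. Qed.

Lemma cmodN z : cmod (- z) = cmod z.
Proof. exact: normcN. Qed.

Lemma cmodB z w : cmod (z - w) <= cmod z + cmod w.
Proof. by rewrite -(cmodN w); exact: cmodD. Qed.

Lemma cmod0 : cmod 0 = 0 :> R.
Proof. exact: Normc.normc0. Qed.

Lemma cmod1 : cmod 1 = 1 :> R.
Proof. exact: Normc.normc1. Qed.

Lemma cmod_eq0 z : cmod z = 0 -> z = 0.
Proof. exact: Normc.eq0_normc. Qed.

Lemma cmodV z : cmod z^-1 = (cmod z)^-1.
Proof. exact: Normc.normcV. Qed.

Lemma cmod_real (r : R) : cmod r%:C = `|r|.
Proof. by rewrite /cmod /= expr0n /= addr0 sqrtr_sqr. Qed.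

Lemma cmod_sqr z : (cmod z ^+ 2)%:C = z * conjc z.
Proof.
case: z => a b; rewrite /cmod /= sqr_sqrtr ?addr_ge0 ?sqr_ge0 //.
by apply/eqP; rewrite eq_complex /=; apply/andP; split; apply/eqP; ring.
Qed.

Lemma cmodX z n : cmod (z ^+ n) = cmod z ^+ n.
Proof. by elim: n => [|n IH]; rewrite ?expr0 ?cmod1 // !exprS cmodM IH. Qed.

Lemma cmod_prod (I : finType) (P : pred I) (f : I -> R[i]) :
  cmod (\prod_(i | P i) f i) = \prod_(i | P i) cmod (f i).
Proof. exact: (big_morph _ cmodM cmod1). Qed.

Lemma cmod_sum (I : finType) (P : pred I) (f : I -> R[i]) :
  cmod (\sum_(i | P i) f i) <= \sum_(i | P i) cmod (f i).
Proof.
elim/big_rec2: _ => [|i a z _ H]; first by rewrite cmod0.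
by apply: le_trans (cmodD _ _) _; rewrite lerD2l.
Qed.

Lemma cmod_circle_conj z : cmod z = 1 -> conjc z = z^-1.
Proof.
move=> z1; have zz : z * conjc z = 1 by rewrite -cmod_sqr z1 expr1n.
have z0 : z != 0 by apply/eqP => z0; move: zz; rewrite z0 mul0r => /eqP;
  rewrite eq_sym oner_eq0.
by apply: (mulfI z0); rewrite zz divff.
Qed.

End Modulus.

(** * Points of the unit circle: chord length against wrap-around distance *)

Section UnitCircle.
Variable R : realType.
Implicit Types t u x y : R.

Lemma expi0 : expi 0 = 1 :> R[i].
Proof. by rewrite /expi cos0 sin0. Qed.

Lemma expiD x y : expi (x + y) = expi x * expi y.
Proof.
rewrite /expi cosD sinD; apply/eqP; rewrite eq_complex /=.
by apply/andP; split; apply/eqP; ring.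
Qed.

Lemma expiX x n : expi x ^+ n = expi (n%:R * x).
Proof.
elim: n => [|n IH]; first by rewrite mul0r expi0.
by rewrite exprS IH -expiD mulrS mulrDl mul1r.
Qed.

Lemma cmod_expi x : cmod (expi x) = 1.
Proof. by rewrite /cmod /= cos2Dsin2 sqrtr1. Qed.

Lemma expiN x : expi (- x) = (expi x)^-1.
Proof.
rewrite -cmod_circle_conj ?cmod_expi // /expi cosN sinN.
by [].
Qed.

Lemma expi_neq0 x : expi x != 0.
Proof.
by apply/eqP => e; have := cmod_expi x; rewrite e cmod0 => /eqP; rewrite eq_sym oner_eq0.
Qed.

Lemma cmod_expiB1_sqr t : cmod (expi t - 1) ^+ 2 = 2 - 2 * cos t.
Proof.
have h := cos2Dsin2 t.
rewrite /cmod /= sqr_sqrtr ?addr_ge0 ?sqr_ge0 //.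
by rewrite subr0 sqrrB1 -addrA -addrCA addrA addrAC; lra.
Qed.

(** The mean value theorem gives [sin u = u * cos z] with [z] between [0] and [u], and cosine
    decreases on [[0, pi]]. *)
Lemma sin_ge_mul_cos u : 0 <= u <= pi -> u * cos u <= sin u.
Proof.
move=> /andP[u0 upi].
have [->|un0] := eqVneq u 0; first by rewrite mul0r sin0.
have {}u0 : 0 < u by rewrite lt_neqAle eq_sym un0.
have [|z /itvP zI] := @MVT_segment _ sin (@cos R) 0 u (ltW u0) (fun x _ => is_derive_sin x).
  exact/continuous_subspaceT/continuous_sin.
rewrite sin0 !subr0 => ->; rewrite mulrC ler_pM2r //.
have [->//|zu] := eqVneq z u.
rewrite ltW // ltr_cos ?in_itv /= ?zI ?(ltW u0) //=; first by rewrite lt_neqAle zu zI.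
by rewrite (le_trans _ upi) ?zI.
Qed.

(** With [u = |t| / 4], doubling the angle twice makes the chord [4 sin u cos u], which is at least
    [4 u cos^2 u]. Since [u <= pi / 4], [cos^2 u >= 1/2], and [2 u] remains. *)
Lemma cmod_expiB1_ge t : `|t| <= pi -> `|t| / 2 <= cmod (expi t - 1).
Proof.
move=> tpi; set u := `|t| / 4.
have u0 : 0 <= u by rewrite divr_ge0.
have pi0 := @pi_gt0 R.
have su : u * cos u <= sin u.
  by apply: sin_ge_mul_cos; rewrite u0 /= /u; move: (normr_ge0 t); lra.
have cu : cos (pi / 4) <= cos u.
  have [->//|ne] := eqVneq u (pi / 4).
  apply: ltW; rewrite ltr_cos ?in_itv /=; first by rewrite lt_neqAle ne /= /u; lra.
    by apply/andP; split => //; rewrite /u; lra.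
  by apply/andP; split; lra.
have c4 : cos (pi / 4 : R) ^+ 2 = 2^-1.
  have := cos_mulr2n (pi / 4 : R); rewrite (_ : pi / 4 *+ 2 = pi / 2) ?cos_pihalf; last lra.
  lra.
have c40 : 0 <= cos (pi / 4 : R) by apply: cos_ge0_pihalf; lra.
have e : cmod (expi t - 1) = `|4 * (sin u * cos u)|.
  apply/eqP; rewrite -(eqrXn2 (n := 2)) ?cmod_ge0 ?normr_ge0 //.
  rewrite cmod_expiB1_sqr -cos_norm real_normK ?num_real //.
  have -> : `|t| = u *+ 2 *+ 2 by rewrite /u; lra.
  rewrite cos_mulr2n cos_mulr2n.
  have := cos2Dsin2 u; move: (cos u) (sin u) => c s h.
  have hs : s ^+ 2 = 1 - c ^+ 2 by lra.
  rewrite !exprMn hs; apply/eqP; ring.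
rewrite e; apply: le_trans (ler_norm _).
have cu2 : 2^-1 <= cos u ^+ 2 by rewrite -c4 lerXn2r // nnegrE (le_trans c40).
have c0 : 0 <= cos u by apply: le_trans cu.
have : u * cos u * cos u <= sin u * cos u by apply: ler_wpM2r.
have : u * 2^-1 <= u * cos u ^+ 2 by apply: ler_wpM2l.
have -> : `|t| / 2 = 2 * u by rewrite /u; lra.
rewrite expr2 mulrA; lra.
Qed.

(** The range covers every difference of two nodes; a shift by at most one period reaches the
    principal interval, so the set from which [xget] chooses is inhabited. *)
Lemma ArgP t : - (2 * pi) < t <= 2 * pi ->
  - pi < Arg (expi t) <= pi /\ expi t = expi (Arg (expi t)).
Proof.
move=> t2; have e1 (r : R) : (cmod (expi t))%:C * expi r = expi r.
  by rewrite cmod_expi; exact: mul1r.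
suff [r rE] : exists r : R, - pi < r <= pi /\ expi t = expi r.
  have /= := @xgetI _ 0 [set r : R | - pi < r <= pi /\ expi t = (cmod (expi t))%:C * expi r] r.
  by rewrite e1 -/(Arg _) => /(_ rE); rewrite e1.
have e2 : expi (pi *+ 2) = 1 :> R[i] by rewrite /expi cos2pi sin2pi.
have pi0 := @pi_gt0 R; case: (lerP t (- pi)) => tl.
  exists (t + pi *+ 2); rewrite expiD e2 mulr1; split => //; lra.
case: (lerP t pi) => tu; first by exists t; rewrite tl tu.
exists (t - pi *+ 2); rewrite expiD expiN e2 invr1 mulr1; split => //; lra.
Qed.

Lemma wrap_dist_spec x y : - pi < x <= pi -> - pi < y <= pi ->
  exists t, [/\ `|t| <= pi, wrap_dist x y = `|t| & expi x = expi y * expi t].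
Proof.
move=> xp yp; have [] := @ArgP (x - y); first by lra.
move=> /andP[a1 a2] e; exists (Arg (expi (x - y))); split => //.
  by rewrite ler_norml a2 ltW.
by rewrite -e -expiD addrC subrK.
Qed.

Lemma wrap_dist_le_pi x y : - pi < x <= pi -> - pi < y <= pi -> wrap_dist x y <= pi.
Proof. by move=> xp yp; have [t [? -> _]] := wrap_dist_spec xp yp. Qed.

(** Taking [m]-th powers multiplies the angle between the points by [m]; the hypothesis keeps the
    new angle within [[-pi, pi]], where the chord bound holds. *)
Lemma chord_ge_wrap_dist x y m : - pi < x <= pi -> - pi < y <= pi ->
  m%:R * wrap_dist x y <= pi ->
  m%:R * wrap_dist x y / 2 <= cmod (expi x ^+ m - expi y ^+ m).
Proof.
move=> xp yp; have [t [_ -> ->]] := wrap_dist_spec xp yp => mt.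
rewrite exprMn -[X in _ - X]mulr1 -mulrBr cmodM cmodX cmod_expi expr1n mul1r.
have mtE : m%:R * `|t| = `|m%:R * t| by rewrite normrM normr_nat.
by rewrite expiX mtE; apply: cmod_expiB1_ge; rewrite -mtE.
Qed.

End UnitCircle.

(** * Roots of unity and the discrete Parseval identity *)

Section DiscreteFourier.
Variable R : realType.

Lemma expi_eq1 (t : R) : `|t| < 2 * pi -> expi t = 1 -> t = 0.
Proof.
have pi0 := @pi_gt0 R.
have small (r : R) : `|r| <= pi -> expi r = 1 -> r = 0.
  move=> rpi r1; have := cmod_expiB1_ge rpi.
  rewrite r1 subrr cmod0 => h; apply/normr0_eq0/le_anti.
  by rewrite normr_ge0 andbT; lra.
have e2 : expi (2 * pi) = 1 :> R[i] by rewrite mulr_natl /expi cos2pi sin2pi.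
move=> t2 t1; have [tpi|tpi] := lerP `|t| pi; first exact: small.
have [t0|t0] := lerP 0 t.
  have : t - 2 * pi = 0.
    apply: small; last by rewrite expiD expiN e2 t1 invr1 mulr1.
    by move: t2 tpi; rewrite ger0_norm // => *; rewrite ler_norml; lra.
  by move: t2; rewrite ger0_norm //; lra.
have : t + 2 * pi = 0.
  apply: small; last by rewrite expiD e2 t1 mulr1.
  by move: t2 tpi; rewrite ltr0_norm // => *; rewrite ler_norml; lra.
by move: t2; rewrite ltr0_norm //; lra.
Qed.

(** For [j != k] the ratio differs from 1, because its angle [2 pi (j - k) / n] is nonzero and below
    [2 pi] in absolute value; the geometric sum then vanishes as the ratio has [n]-th power 1. *)
Lemma sum_unity_root (n : nat) (j k : 'I_n) (w := expi (2 * pi / n%:R) : R[i]) :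
  \sum_(a < n) (w ^+ j / w ^+ k) ^+ a = if j == k then n%:R else 0.
Proof.
have [->|jk] := eqVneq j k.
  under eq_bigr do rewrite divff ?expf_neq0 ?expi_neq0 // expr1n.
  by rewrite sumr_const card_ord.
have n0 : n%:R != 0 :> R by rewrite pnatr_eq0 -lt0n (leq_ltn_trans _ (ltn_ord j)).
have z1 : w ^+ j / w ^+ k - 1 != 0.
  rewrite !expiX -expiN -expiD subr_eq0; apply/eqP => /expi_eq1.
  have -> : j%:R * (2 * pi / n%:R) - k%:R * (2 * pi / n%:R) =
     (j%:R - k%:R) * (2 * pi / n%:R) :> R by ring.
  have npos : 0 < n%:R :> R by rewrite lt_neqAle eq_sym n0 ler0n.
  have pi0 := @pi_gt0 R.
  have hn : 0 < 2 * pi / n%:R :> R by rewrite divr_gt0 ?mulr_gt0.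
  rewrite normrM (gtr0_norm hn) mulrA ltr_pdivrMr // mulrC ltr_pM2l ?mulr_gt0 //.
  have jn : j%:R < n%:R :> R by rewrite ltr_nat.
  have kn : k%:R < n%:R :> R by rewrite ltr_nat.
  have j0 : 0 <= j%:R :> R by [].
  have k0 : 0 <= k%:R :> R by [].
  rewrite ltr_norml => /(_ ltac:(lra)) /eqP.
  by rewrite mulf_eq0 (gt_eqF hn) orbF subr_eq0 eqr_nat; apply/negP.
apply: (mulfI z1); rewrite mulr0 -subrX1 exprMn exprVn -!exprM mulnC exprM [(k * n)%N]mulnC exprM.
have -> : w ^+ n = 1.
  by rewrite expiX mulrC divfK // mulr_natl /expi cos2pi sin2pi.
by rewrite !expr1n invr1 mulr1 subrr.
Qed.

(** Expanding the squared moduli gives a triple sum whose off-diagonal terms cancel by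
    orthogonality; [size p <= n] excludes aliasing of coefficients. *)
Lemma discrete_parseval (n : nat) (p : {poly R[i]}) (w := expi (2 * pi / n%:R) : R[i]) :
  (size p <= n)%N ->
  \sum_(a < n) cmod p.[w ^+ a] ^+ 2 = n%:R * \sum_(k < n) cmod p`_k ^+ 2.
Proof.
move=> pn; apply: complexI; rewrite rmorphM !rmorph_sum /= rmorph_nat mulr_sumr.
transitivity (\sum_(a < n) \sum_(j < n) \sum_(k < n)
   p`_j * conjc p`_k * (w ^+ j / w ^+ k) ^+ a).
  apply: eq_bigr => a _; rewrite cmod_sqr (horner_coef_wide _ pn) rmorph_sum /=.
  rewrite big_distrlr /=; apply: eq_bigr => j _; apply: eq_bigr => k _.
  have wE : conjc (w ^+ a ^+ k) = (w ^+ a ^+ k)^-1.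
    by apply: cmod_circle_conj; rewrite !cmodX cmod_expi !expr1n.
  rewrite rmorphM /= wE.
  by rewrite exprMn exprVn -!exprM ![(a * _)%N]mulnC; ring.
rewrite exchange_big; apply: eq_bigr => j _ /=; rewrite exchange_big /=.
under eq_bigr do rewrite -mulr_sumr sum_unity_root.
rewrite (bigD1 j) //= eqxx big1 ?addr0 => [|k kj].
  by rewrite -cmod_sqr mulrC.
by rewrite eq_sym (negPf kj) mulr0.
Qed.

(** Parseval turns both coefficient sums into sums over the [n]-th roots of unity, where the
    inequality holds term by term. *)
Lemma sum_coef_mul_le (n : nat) (p q : {poly R[i]}) (c : R) :
  (0 < n)%N -> (size p <= n)%N -> (size (p * q)%R <= n)%N ->
  (forall z, cmod z = 1 -> cmod q.[z] <= c) ->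
  \sum_(k < n) cmod (p * q)`_k ^+ 2 <= c ^+ 2 * \sum_(k < n) cmod p`_k ^+ 2.
Proof.
move=> n0 pn pqn qc; have n0' : 0 < n%:R :> R by rewrite ltr0n.
rewrite -(ler_pM2l n0') mulrCA -!discrete_parseval // mulr_sumr.
apply: ler_sum => a _; rewrite hornerM cmodM exprMn mulrC.
apply: ler_wpM2r; first exact: sqr_ge0.
have w1 : cmod (expi (2 * pi / n%:R : R) ^+ a) = 1 by rewrite cmodX cmod_expi expr1n.
by rewrite lerXn2r ?nnegrE ?cmod_ge0 ?(le_trans (cmod_ge0 _) (qc _ w1)) // qc.
Qed.

End DiscreteFourier.

(** * Least squares: existence of the minimizer and error bounds by duality *)

Section LeastSquares.
Variable R : realType.

(** Lagrange's identity: the gap between the two sides is half of a double sum of squares. *)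
Lemma cauchy_schwarz_sum (n : nat) (f g : 'I_n -> R) :
  (\sum_(i < n) f i * g i) ^+ 2 <= (\sum_(i < n) f i ^+ 2) * (\sum_(i < n) g i ^+ 2).
Proof.
have : 0 <= \sum_(i < n) \sum_(j < n) (f i * g j - f j * g i) ^+ 2.
  by apply: sumr_ge0 => i _; apply: sumr_ge0 => j _; exact: sqr_ge0.
have -> : \sum_(i < n) (\sum_(j < n) (f i * g j - f j * g i) ^+ 2) =
  \sum_(i < n) \sum_(j < n) (f i ^+ 2 * g j ^+ 2 + g i ^+ 2 * f j ^+ 2
    - 2 * ((f i * g i) * (f j * g j))).
  by apply: eq_bigr => i _; apply: eq_bigr => j _; ring.
under eq_bigr do rewrite sumrB big_split /= -mulr_sumr -!mulr_sumr.
rewrite sumrB big_split /= -!mulr_suml -mulr_sumr -!mulr_suml.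
set A := \sum_(i < n) f i ^+ 2; set B := \sum_(i < n) g i ^+ 2.
by rewrite -expr2 [B * A]mulrC; lra.
Qed.

Lemma norm2_le (m : nat) (v w : 'cV[R[i]]_m) : (norm2 v <= norm2 w) =
  (\sum_(k < m) cmod (v k 0) ^+ 2 <= \sum_(k < m) cmod (w k 0) ^+ 2).
Proof. by rewrite /norm2 ler_sqrt // sumr_ge0 // => k _; exact: sqr_ge0. Qed.

Lemma norm_infty_ge0 (m : nat) (v : 'cV[R[i]]_m) : 0 <= norm_infty v.
Proof.
by rewrite /norm_infty; elim/big_rec: _ => // i a _ a0; rewrite le_max a0 orbT.
Qed.

Lemma cmod_le_norm_infty (m : nat) (v : 'cV[R[i]]_m) k : cmod (v k 0) <= norm_infty v.
Proof. by rewrite /norm_infty (bigD1 k) //= le_max lexx. Qed.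

Let adj (m n : nat) (A : 'M[R[i]]_(m, n)) : 'M[R[i]]_(n, m) := (map_mx conjc A)^T.

Let adjM_col (m : nat) (v : 'cV[R[i]]_m) :
  (adj v *m v) 0 0 = (\sum_(k < m) cmod (v k 0) ^+ 2)%:C.
Proof.
rewrite mxE rmorph_sum; apply: eq_bigr => k _ /=.
by rewrite cmod_sqr !mxE mulrC.
Qed.

Let adjM m n p (A : 'M[R[i]]_(m, n)) (B : 'M[R[i]]_(n, p)) : adj (A *m B) = adj B *m adj A.
Proof. by rewrite /adj map_mxM trmx_mul. Qed.

Let adjD m n (A B : 'M[R[i]]_(m, n)) : adj (A + B) = adj A + adj B.
Proof. by rewrite /adj map_mxD linearD. Qed.

Let adjK m n (A : 'M[R[i]]_(m, n)) : adj (adj A) = A.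
Proof. by apply/matrixP => i j; rewrite !mxE conjcK. Qed.

Lemma sum_sqr_cmod_eq0 (m : nat) (v : 'cV[R[i]]_m) :
  \sum_(k < m) cmod (v k 0) ^+ 2 = 0 -> v = 0.
Proof.
move=> /eqP; rewrite psumr_eq0 => [/allP v0|k _]; last exact: sqr_ge0.
apply/matrixP => i j; rewrite ord1 mxE; apply: cmod_eq0; apply/eqP.
by rewrite -sqrf_eq0; apply: v0; rewrite mem_index_enum.
Qed.

(** Injectivity of [V] makes the Gram matrix invertible. The solution of the normal equations has a
    residual orthogonal to the range of [V], so Pythagoras shows that it is a minimizer. *)
Lemma least_squaresP (m n : nat) (V : 'M[R[i]]_(m, n)) (b : 'cV[R[i]]_m) :
  (forall c : 'cV[R[i]]_n, V *m c = 0 -> c = 0) -> is_least_squares V b (least_squares V b).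
Proof.
move=> Vinj; apply: (@xgetPex _ 0 [set a | is_least_squares V b a]).
have gram_inj (c : 'cV[R[i]]_n) : adj V *m V *m c = 0 -> c = 0.
  move=> h; apply: Vinj; apply: sum_sqr_cmod_eq0; apply: complexI.
  by rewrite -adjM_col adjM -mulmxA (mulmxA _ V) h mulmx0 mxE.
(* [kermx] is a left kernel, hence the transposes: a row of the kernel of the transposed Gram matrix
   is a column annihilated by the Gram matrix. *)
have gram_unit : adj V *m V \in unitmx.
  rewrite -unitmx_tr -row_free_unit -kermx_eq0; apply/eqP/row_matrixP => i.
  rewrite row0; apply: trmx_inj; rewrite trmx0; apply: gram_inj.
  by apply: trmx_inj; rewrite trmx_mul trmxK trmx0 -row_mul mulmx_ker row0.
exists (invmx (adj V *m V) *m (adj V *m b)) => a'; set a := invmx _ *m _.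
have orth : adj V *m (V *m a - b) = 0.
  by rewrite mulmxBr mulmxA mulmxA mulmxV // mul1mx subrr.
have orth' : adj (V *m a - b) *m V = 0.
  by have := adjM (adj V) (V *m a - b); rewrite orth adjK => <-; rewrite /adj map_mx0 trmx0.
rewrite norm2_le -lecR -!adjM_col.
have -> : V *m a' - b = V *m (a' - a) + (V *m a - b) by rewrite mulmxBr addrA subrK.
move: (a' - a) (V *m a - b) orth orth' => d e orth orth'.
rewrite adjD mulmxDl !mulmxDr [adj e *m (V *m d)]mulmxA orth' mul0mx add0r.
rewrite [adj (V *m d) *m e](_ : _ = 0) ?addr0; last first.
  by rewrite adjM -mulmxA orth mulmx0.
rewrite [leRHS]mxE.
by rewrite lerDr adjM_col lecR sumr_ge0 // => k _; exact: sqr_ge0.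
Qed.

(* Since [V a0] competes with the minimizer [a], [V (a - a0)] has 2-norm at most
   [2 ||b - V a0||]; pairing it with [u] gives the component [l] of [a - a0]. *)
Lemma least_squares_dual_bound (m n : nat) (V : 'M[R[i]]_(m, n)) (b : 'cV[R[i]]_m)
    (a a0 : 'cV[R[i]]_n) (l : 'I_n) (u : 'I_m -> R[i]) :
  is_least_squares V b a ->
  (forall k, \sum_(i < m) u i * V i k = (k == l)%:R) ->
  cmod ((a - a0) l 0) ^+ 2 <=
    4 * m%:R * norm_infty (b - V *m a0) ^+ 2 * \sum_(i < m) cmod (u i) ^+ 2.
Proof.
move=> aP uP; set E := norm_infty _.
have -> : (a - a0) l 0 = \sum_(i < m) u i * (V *m (a - a0)) i 0.
  under eq_bigr do rewrite mxE mulr_sumr.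
  rewrite exchange_big /=; under eq_bigr do under eq_bigr do rewrite mulrA.
  under eq_bigr do rewrite -mulr_suml uP.
  rewrite (bigD1 l) //= eqxx mul1r big1 ?addr0 // => k kl.
  by rewrite (negPf kl) mul0r.
set w := V *m (a - a0).
apply: le_trans (_ : (\sum_(i < m) cmod (u i) * cmod (w i 0)) ^+ 2 <= _).
  rewrite lerXn2r ?nnegrE ?cmod_ge0 ?sumr_ge0 //.
    by move=> i _; rewrite mulr_ge0 ?cmod_ge0.
  by apply: le_trans (cmod_sum _ _) _; apply: ler_sum => i _; rewrite cmodM.
apply: le_trans (cauchy_schwarz_sum _ _) _; rewrite mulrC.
apply: ler_wpM2r; first by apply: sumr_ge0 => i _; exact: sqr_ge0.
have := aP a0; rewrite norm2_le => ha.
have hE : \sum_(k < m) cmod ((V *m a0 - b) k 0) ^+ 2 <= m%:R * E ^+ 2.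
  apply: le_trans (_ : \sum_(k < m) E ^+ 2 <= _); last by rewrite sumr_const card_ord mulr_natl.
  apply: ler_sum => k _; rewrite lerXn2r ?nnegrE ?cmod_ge0 ?norm_infty_ge0 //.
  have -> : (V *m a0 - b) k 0 = - (b - V *m a0) k 0 by rewrite -opprB mxE.
  by rewrite cmodN cmod_le_norm_infty.
(* [w] is the difference of the residuals at [a] and [a0], and [(p + q)^2 <= 2 p^2 + 2 q^2]. Each
   residual has squared 2-norm at most [m E^2], whence the factor [4 m]. *)
apply: le_trans (_ : \sum_(k < m) (2 * cmod ((V *m a - b) k 0) ^+ 2
   + 2 * cmod ((V *m a0 - b) k 0) ^+ 2) <= _).
  apply: ler_sum => k _.
  have -> : w k 0 = (V *m a - b) k 0 - (V *m a0 - b) k 0.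
    by rewrite /w mulmxBr !mxE; ring.
  set p := cmod ((V *m a - b) k 0); set q := cmod ((V *m a0 - b) k 0).
  have h : cmod ((V *m a - b) k 0 - (V *m a0 - b) k 0) <= p + q by exact: cmodB.
  apply: le_trans (_ : (p + q) ^+ 2 <= _).
    by rewrite lerXn2r ?nnegrE ?addr_ge0 ?cmod_ge0.
  by have := sqr_ge0 (p - q); rewrite sqrrB sqrrD; lra.
by rewrite big_split /= -!mulr_sumr; lra.
Qed.

End LeastSquares.

(** * Interpolating polynomials built from Dirichlet and Fejer kernels *)

Section Kernels.
Variable R : realType.
Implicit Types x y z w : R[i].

(** The Dirichlet kernel centred at [z], as a polynomial normalized to the value 1 at [z] for
    [d > 0]; on the circle [z^-k] is the conjugate of [z^k]. *)
Definition dirichlet_poly (d : nat) z : {poly R[i]} :=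
  \poly_(k < d) (d%:R^-1 * z ^- k).

Lemma unit_circle_neq0 z : cmod z = 1 -> z != 0.
Proof.
by move=> z1; apply/eqP => z0; move: z1; rewrite z0 cmod0 => /esym/eqP; rewrite oner_eq0.
Qed.

Lemma horner_dirichlet d z x :
  (dirichlet_poly d z).[x] = d%:R^-1 * \sum_(k < d) (x / z) ^+ k.
Proof.
rewrite horner_poly mulr_sumr; apply: eq_bigr => k _.
by rewrite exprMn exprVn [x ^+ k * _]mulrC mulrA.
Qed.

Lemma horner_dirichlet_center d z : (0 < d)%N -> z != 0 -> (dirichlet_poly d z).[z] = 1.
Proof.
move=> d0 z0; rewrite horner_dirichlet divff //.
under eq_bigr do rewrite expr1n.
by rewrite sumr_const card_ord mulVf // pnatr_eq0 -lt0n.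
Qed.

Lemma cmod_natr (n : nat) : cmod (n%:R : R[i]) = n%:R.
Proof. by rewrite -(rmorph_nat (real_complex R)) cmod_real normr_nat. Qed.

Lemma sum_coef_dirichlet d n z : (0 < d <= n)%N -> cmod z = 1 ->
  \sum_(k < n) cmod (dirichlet_poly d z)`_k ^+ 2 = d%:R^-1.
Proof.
move=> /andP[d0 dn] z1.
under eq_bigr => k _ do rewrite coef_poly.
rewrite -(big_mkord xpredT (fun k => cmod (if (k < d)%N then d%:R^-1 * z ^- k else 0) ^+ 2)).
rewrite (big_cat_nat (n := d)) //= [X in _ + X]big_nat_cond [X in _ + X]big1 ?addr0; last first.
  by move=> k /andP[/andP[dk _] _]; rewrite ifF ?cmod0 ?expr0n //; apply/negbTE; rewrite -leqNgt.
rewrite big_mkord; under eq_bigr => k _.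
  rewrite ltn_ord cmodM !cmodV cmodX z1 expr1n invr1 mulr1 cmod_natr.
  over.
rewrite sumr_const card_ord -[LHS]mulr_natr expr2 -mulrA mulVf ?mulr1 //.
by rewrite pnatr_eq0 -lt0n.
Qed.

(** Decay away from the centre, by summing the geometric series; the product form also covers
    [x = z]. *)
Lemma cmod_dirichlet_le d z x : cmod z = 1 -> cmod x = 1 ->
  cmod (dirichlet_poly d z).[x] * (d%:R * cmod (x - z)) <= 2.
Proof.
move=> z1 x1; have z0 := unit_circle_neq0 z1.
have [->|d0] := eqVneq d 0%N; first by rewrite mul0r mulr0.
have -> : cmod (x - z) = cmod (x / z - 1).
  by rewrite -[in RHS](divff z0) -mulrBl cmodM cmodV z1 invr1 mulr1.
rewrite -cmod_natr -!cmodM horner_dirichlet mulrACA mulVf ?pnatr_eq0 // mul1r.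
rewrite mulrC -subrX1; apply: le_trans (cmodB _ _) _.
by rewrite cmodX cmodM cmodV x1 z1 invr1 mulr1 expr1n cmod1.
Qed.

Lemma cmod_dirichlet_le1 d z x : cmod z = 1 -> cmod x = 1 ->
  cmod (dirichlet_poly d z).[x] <= 1.
Proof.
move=> z1 x1; have [->|d0] := eqVneq d 0%N.
  by rewrite horner_dirichlet big_ord0 mulr0 cmod0.
rewrite horner_dirichlet cmodM cmodV cmod_natr ler_pdivrMl ?ltr0n ?lt0n // mulr1.
apply: le_trans (cmod_sum _ _) _; rewrite -[leRHS]mulr1n -[d in leRHS]card_ord -[leRHS]sumr_const.
by apply: ler_sum => k _; rewrite cmodX cmodM cmodV x1 z1 invr1 mulr1 expr1n.
Qed.

(* On the circle [z^q K^2 = x^q |K|^2], because [z^q K(x) = x^q (K(x))^*]: up to a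
   phase, the polynomial below is one minus the Fejer kernel centred at [z]. *)
Lemma cmod_fejer q z x (K := dirichlet_poly q.+1 z) : cmod z = 1 -> cmod x = 1 ->
  cmod (x ^+ q - z ^+ q * K.[x] ^+ 2) = 1 - cmod K.[x] ^+ 2.
Proof.
move=> z1 x1; have z0 := unit_circle_neq0 z1; have x0 := unit_circle_neq0 x1.
have conjK : z ^+ q * K.[x] = x ^+ q * conjc K.[x].
  have cE : conjc (\sum_(k < q.+1) (x / z) ^+ k) = \sum_(k < q.+1) (z / x) ^+ k :> R[i].
    rewrite rmorph_sum /=; apply: eq_bigr => k _.
    have -> : conjc ((x / z) ^+ k) = ((x / z) ^+ k)^-1.
      by apply: cmod_circle_conj; rewrite cmodX cmodM cmodV x1 z1 invr1 mulr1 expr1n.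
    by rewrite -exprVn invf_div.
  have dE : conjc ((q.+1%:R : R[i])^-1) = q.+1%:R^-1 by rewrite conjc_inv conjc_nat.
  have -> : conjc K.[x] = q.+1%:R^-1 * \sum_(k < q.+1) (z / x) ^+ k.
    by rewrite horner_dirichlet rmorphM /=; congr (_ * _).
  rewrite horner_dirichlet !mulrA ![_ * q.+1%:R^-1]mulrC -!mulrA.
  (* Reversing the order of summation matches the terms, since [z^q (x/z)^(q-k) = x^q (z/x)^k]. *)
  congr (_ * _); rewrite !mulr_sumr (reindex_inj rev_ord_inj) /=.
  apply: eq_bigr => k _; have kq : (k <= q)%N by rewrite -ltnS.
  have qE w : w ^+ q = w ^+ (q - k) * w ^+ k by rewrite -exprD subnK.
  rewrite subSS !exprMn !exprVn [z ^+ q]qE [x ^+ q]qE.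
  have := expf_neq0 (q - k) z0; have := expf_neq0 k x0.
  move: (z ^+ (q - k)) (x ^+ k) => a b b0 a0.
  by field; rewrite a0 b0.
have -> : x ^+ q - z ^+ q * K.[x] ^+ 2 = x ^+ q * (1 - cmod K.[x] ^+ 2)%:C.
  by rewrite rmorphB /= cmod_sqr expr2 mulrA conjK rmorph1; ring.
rewrite cmodM cmodX x1 expr1n mul1r cmod_real ger0_norm // subr_ge0.
by rewrite expr_le1 ?cmod_ge0 ?cmod_dirichlet_le1.
Qed.

(** Before division by its value [c] at [w], the Fejer factor has modulus [1 - |K|^2 <= 1] on the
    circle. Decay of [K] gives [|K(w)| <= r], so [|c| >= 1 - r^2]. *)
Lemma far_factor q y w (r : R) : cmod y = 1 -> cmod w = 1 ->
  0 <= r < 1 -> 2 <= r * (q.+1%:R * cmod (w - y)) ->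
  exists B : {poly R[i]}, [/\ (size B <= (2 * q).+1)%N, B.[y] = 0, B.[w] = 1 &
    forall x, cmod x = 1 -> cmod B.[x] <= (1 - r ^+ 2)^-1].
Proof.
move=> y1 w1 /andP[r0 r1] hr; set K := dirichlet_poly q.+1 y.
have y0 := unit_circle_neq0 y1.
set c := w ^+ q - y ^+ q * K.[w] ^+ 2.
have Kw : cmod K.[w] <= r.
  have := cmod_dirichlet_le q.+1 y1 w1; rewrite -/K => h.
  have p0 : 0 < q.+1%:R * cmod (w - y).
    rewrite lt_neqAle mulr_ge0 ?cmod_ge0 // andbT eq_sym.
    by apply/eqP => e; move: hr; rewrite e mulr0; lra.
  by rewrite -(ler_pM2r p0) (le_trans h).
have r2 : 0 < 1 - r ^+ 2 by rewrite subr_gt0 expr_lt1.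
have cge : 1 - r ^+ 2 <= cmod c.
  by rewrite cmod_fejer // lerD2l lerN2 lerXn2r ?nnegrE ?cmod_ge0.
have c0 : c != 0 by apply/eqP => e; move: cge; rewrite e cmod0 leNgt r2.
have hE x : (c^-1 *: ('X^q - (y ^+ q)%:P * K ^+ 2)).[x] =
    c^-1 * (x ^+ q - y ^+ q * K.[x] ^+ 2) by rewrite !hornerE ?expr2.
exists (c^-1 *: ('X^q - (y ^+ q)%:P * K ^+ 2)); split.
- apply: leq_trans (size_scale_leq _ _) _; apply: leq_trans (size_polyD _ _) _.
  rewrite size_polyN geq_max size_polyXn ltnS leq_pmull //= mul_polyC.
  apply: leq_trans (size_scale_leq _ _) _.
  apply: leq_trans (size_poly_exp_leq _ _) _; rewrite ltnS mulnC leq_mul2l /=.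
  have sK : (size K <= q.+1)%N by exact: size_poly.
  by case: (size K) sK.
- by rewrite hE horner_dirichlet_center // expr1n mulr1 subrr mulr0.
- by rewrite hE mulVf.
move=> x x1; rewrite hE cmodM cmodV (cmod_fejer q y1 x1).
rewrite mulrC ler_pdivrMr ?(lt_le_trans r2) //.
apply: le_trans (_ : 1 <= _); first by rewrite gerBl sqr_ge0.
by rewrite mulrC ler_pdivlMr // mul1r.
Qed.

(** The numerator [x^m - y^m] is at most 2 on the circle. Compared with a linear factor, the power
    [m] lengthens the short chord in the denominator. *)
Lemma near_factor m y w (g : R) : cmod y = 1 ->
  2 <= g * cmod (w ^+ m - y ^+ m) ->
  exists G : {poly R[i]}, [/\ (size G <= m.+1)%N, G.[y] = 0, G.[w] = 1 &
    forall x, cmod x = 1 -> cmod G.[x] <= g].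
Proof.
move=> y1; set c := w ^+ m - y ^+ m => hg.
have c0 : c != 0 by apply/eqP => e; move: hg; rewrite e cmod0 mulr0; lra.
have cp : 0 < cmod c.
  by rewrite lt_neqAle cmod_ge0 andbT eq_sym; apply: contraNneq c0 => /cmod_eq0 ->.
exists (c^-1 *: ('X^m - (y ^+ m)%:P)); split.
- apply: leq_trans (size_scale_leq _ _) _; apply: leq_trans (size_polyD _ _) _.
  by rewrite size_polyN geq_max size_polyXn leqnn (leq_trans (size_polyC_leq1 _)).
- by rewrite !hornerE subrr mulr0.
- by rewrite !hornerE mulVf.
move=> x x1; rewrite !hornerE /= cmodM cmodV mulrC ler_pdivrMr //.
apply: le_trans hg; apply: le_trans (cmodB _ _) _.
by rewrite !cmodX x1 y1 !expr1n.
Qed.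

Lemma horner_prod_poly (I : finType) (P : pred I) (F : I -> {poly R[i]}) x :
  (\prod_(i | P i) F i).[x] = \prod_(i | P i) (F i).[x].
Proof. exact: (big_morph (horner^~ x) (fun p q => hornerM p q x) (hornerC 1 x)). Qed.

Lemma size_prod_le (I : finType) (P : pred I) (F : I -> {poly R[i]}) n :
  (forall i, P i -> (size (F i) <= n.+1)%N) ->
  (size (\prod_(i | P i) F i)%R <= (#|P| * n).+1)%N.
Proof.
move=> h; apply: leq_trans (size_poly_prod_leq _ _) _.
by rewrite leq_subLR addnS ltnS -mulnS -sum_nat_const; exact: leq_sum.
Qed.

(* The product of the near and far factors multiplies the Dirichlet polynomial
   centred at [z l]; Parseval turns its sup bound on the circle into a bound on
   the coefficients. *)
Lemma dual_vector (n N m q d : nat) (z : 'I_n -> R[i]) (l : 'I_n) (own : pred 'I_n)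
    (g r : R) (c := #|[pred k | own k && (k != l)]|) :
  (forall k, cmod (z k) = 1) -> own l -> 0 <= g -> 0 <= r < 1 ->
  (forall k, own k -> k != l -> 2 <= g * cmod (z l ^+ m - z k ^+ m)) ->
  (forall k, ~~ own k -> 2 <= r * (q.+1%:R * cmod (z l - z k))) ->
  (0 < d)%N -> (d + c * m + n * (2 * q) <= N)%N ->
  exists u : 'I_N -> R[i],
    (forall k, \sum_(i < N) u i * z k ^+ i = (k == l)%:R) /\
    \sum_(i < N) cmod (u i) ^+ 2 <=
      d%:R^-1 * (g ^+ c * (1 - r ^+ 2)^-1 ^+ n) ^+ 2.
Proof.
move=> z1 ownl g0 r01 near far d0 dN.
pose near_spec k (G : {poly R[i]}) := [/\ (size G <= m.+1)%N, G.[z k] = 0, G.[z l] = 1 &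
    forall x, cmod x = 1 -> cmod G.[x] <= g].
(* Indices outside the class receive the default 0, which never enters the product; likewise for [B]
   below. *)
have /choice[G GP] k : exists G, own k && (k != l) -> near_spec k G.
  case: (boolP (own k && (k != l))) => [/andP[ok kl]|_]; last by exists 0.
  by have [G GP] := near_factor (z1 k) (near k ok kl); exists G.
pose far_spec k (B : {poly R[i]}) := [/\ (size B <= (2 * q).+1)%N, B.[z k] = 0, B.[z l] = 1 &
    forall x, cmod x = 1 -> cmod B.[x] <= (1 - r ^+ 2)^-1].
have /choice[B BP] k : exists B, ~~ own k -> far_spec k B.
  case: (boolP (own k)) => [_|ok]; first by exists 0.
  by have [B BP] := far_factor (z1 k) (z1 l) r01 (far k ok); exists B.
set GG := \prod_(k | own k && (k != l)) G k.
set BB := \prod_(k | ~~ own k) B k.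
set D := dirichlet_poly d (z l).
have zl0 := unit_circle_neq0 (z1 l).
have sD : (size D <= d)%N by exact: size_poly.
have sGG : (size GG <= (c * m).+1)%N by apply: size_prod_le => k /GP[].
have sBB : (size BB <= (n * (2 * q)).+1)%N.
  apply: leq_trans (size_prod_le (n := 2 * q) _) _; first by move=> k /BP[].
  by rewrite ltnS leq_mul2r -[leqRHS]card_ord max_card orbT.
have sGB : (size (GG * BB)%R <= (c * m + n * (2 * q)).+1)%N.
  by apply: leq_trans (size_polyMleq _ _) _; move: (c * m)%N (n * (2 * q))%N sGG sBB; lia.
have sP : (size (D * (GG * BB))%R <= N)%N.
  by apply: leq_trans (size_polyMleq _ _) _; move: (c * m)%N (n * (2 * q))%N sGB dN; lia.
exists (fun i => (D * (GG * BB))`_i); split.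
  (* The size bound makes the pairing with the powers of [z k] an evaluation at [z k], where some
     factor vanishes unless [k = l]. *)
  move=> k; rewrite -(horner_coef_wide _ sP) !hornerM !horner_prod_poly.
  have [->|kl] := eqVneq k l.
    rewrite horner_dirichlet_center // mul1r !big1 ?mulr1 //.
      by move=> i /BP[].
    by move=> i /GP[].
  case: (boolP (own k)) => ok.
    rewrite [\prod_(i | own i && _) _](bigD1 k) ?ok //=.
    by have [|_ -> _ _] := GP k; rewrite ?ok // !(mul0r, mulr0).
  rewrite [\prod_(i | ~~ own i) _](bigD1 k) //=.
  by have [_ -> _ _] := BP k ok; rewrite !(mul0r, mulr0).
rewrite [leRHS]mulrC -(sum_coef_dirichlet (n := N) _ (z1 l)); last by rewrite d0 /=; lia.
apply: sum_coef_mul_le => //; [lia | lia | move=> x x1].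
rewrite hornerM !horner_prod_poly cmodM !cmod_prod.
have r2 : 0 < 1 - r ^+ 2.
  by case/andP: r01 => r0 r1; rewrite subr_gt0 expr_lt1.
have rV1 : 1 <= (1 - r ^+ 2)^-1 by rewrite invf_ge1 // gerBl sqr_ge0.
have rV0 : 0 <= (1 - r ^+ 2)^-1 by apply: le_trans rV1.
apply: ler_pM; rewrite ?prodr_ge0 //; try by move=> *; exact: cmod_ge0.
  rewrite -[g ^+ c](prodr_const [pred k | own k && (k != l)] g).
  apply: ler_prod => k ok; rewrite cmod_ge0 /=.
  by have [_ _ _ ->] := GP k ok.
(* Each bound is at least 1, so the exponent may grow from the number of far nodes to [n]. *)
apply: le_trans (_ : \prod_(k | ~~ own k) (1 - r ^+ 2)^-1 <= _).
  apply: ler_prod => k ok; rewrite cmod_ge0 /=.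
  by have [_ _ _ ->] := BP k ok.
rewrite (prodr_const [pred k | ~~ own k]); apply: ler_weXn2l => //.
by rewrite -[leqRHS]card_ord max_card.
Qed.

End Kernels.

(** * Choice of degrees for a clustered configuration *)

Section Clusters.
Variable R : realType.

Lemma bernoulli_le (e : R) n : 0 <= e <= 1 -> 1 - n%:R * e <= (1 - e) ^+ n.
Proof.
move=> /andP[e0 e1]; elim: n => [|n IH]; first by rewrite mul0r subr0 expr0.
rewrite exprS; apply: le_trans (ler_wpM2l _ IH); last by rewrite subr_ge0.
have : 0 <= n%:R * e ^+ 2 by rewrite mulr_ge0 ?sqr_ge0.
by rewrite mulrS; lra.
Qed.

(** Passes from the cardinality of a set of nodes to that of its finite set of indices, by
    enumerating the latter; [l] is the default entry of [nth]. *)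
Lemma card_preimage_cluster (n s : nat) (x : 'I_n -> R) (l : 'I_n) (C : set R) :
  injective x -> C `<=` range x -> (C #= `I_s)%card -> #|[pred k | `[< C (x k) >]]| = s.
Proof.
move=> xinj Cx Cs; set P := [pred k | _].
have CE : C = [set x (nth l (enum P) i) | i in `I_#|P|].
  apply/seteqP; split => [y Cy|_ [i /= iP <-]].
    have [k _ ky] := Cx _ Cy.
  have kP : k \in enum P by rewrite mem_enum unfold_in /= ky; apply/asboolP.
  by exists (index k (enum P)) => /=; rewrite ?nth_index // cardE index_mem.
  have : nth l (enum P) i \in P by rewrite -mem_enum mem_nth // -cardE.
  by rewrite unfold_in => /asboolP.
apply/card_eq_II; apply: card_eq_trans Cs.
rewrite CE card_eq_sym; apply: inj_card_eq => i j /[!inE] /= iP jP /xinj /eqP.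
by rewrite nth_uniq ?enum_uniq -?cardE // => /eqP.
Qed.

Lemma cluster_dual_vector (n N s : nat) (x : 'I_n -> R) (l : 'I_n) (own : pred 'I_n)
    (h tau theta : R) :
  (forall k, - pi < x k <= pi) -> own l -> #|own| = s ->
  0 < h -> 0 < tau -> 0 < theta ->
  (forall k, own k -> k != l -> tau * h <= wrap_dist (x l) (x k) <= h) ->
  (forall k, ~~ own k -> theta <= wrap_dist (x l) (x k)) ->
  (n < N)%N -> 64 * n.+1%:R ^+ 3 <= N%:R * theta -> N%:R * h <= 1 ->
  exists u : 'I_N.+1 -> R[i],
    (forall k, \sum_(i < N.+1) u i * expi (x k) ^+ i = (k == l)%:R) /\
    \sum_(i < N.+1) cmod (u i) ^+ 2 <=
      8 * s%:R / N.+1%:R * ((8 * s%:R / tau) ^+ (s - 1) * (1 / (N%:R * h)) ^+ (s - 1)) ^+ 2.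
Proof.
move=> xpi ownl ownE h0 tau0 theta0 near far nN thetaN hN.
have s0 : (0 < s)%N by rewrite -ownE; apply/card_gt0P; exists l.
have sn : (s <= n)%N by rewrite -ownE -[leqRHS]card_ord max_card.
(* The degree budget: the near factors use [(s - 1) m], the far ones [2 n q <= m / 2], and
   [d <= m / 2 + 1]. The total is at most [s m + 1 <= N + 1], the number of coefficients. *)
set m := (N %/ s)%N; set q := (m %/ (4 * n.+1))%N; set d := (m %/ 2).+1.
have N0 : (0 < N)%N by apply: leq_ltn_trans nN.
have N0' : 0 < N%:R :> R by rewrite ltr0n.
have s0' : 0 < s%:R :> R by rewrite ltr0n.
have m0 : (0 < m)%N by rewrite divn_gt0 // (leq_trans sn) // ltnW.
have msN : (m * s <= N)%N by exact: leq_divM.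
have mSs : (N.+1 <= m.+1 * s)%N by exact: ltn_ceil.
have qE : (m < q.+1 * (4 * n.+1))%N by exact: ltn_ceil.
have qm : (q * (4 * n.+1) <= m)%N by exact: leq_divM.
have dE : (m < d * 2)%N by exact: ltn_ceil.
have dm : (d * 2 <= m + 2)%N by rewrite mulSn addnC leq_add2r; exact: leq_divM.
have mN : (m <= N)%N by exact: leq_div.
have d0 : (0 < d)%N by [].
clearbody m q d.
have cE : #|[pred k | own k && (k != l)]| = (s - 1)%N.
  rewrite -ownE (cardD1 l own) -topredE /= ownl add1n subn1 /=.
  by apply: eq_card => k; rewrite !inE andbC.
(* The chord between [m]-th powers is at least [m tau h / 2], and [m s >= N / 2]; this [g] makes the
   product with the chord at least [4 m s / N >= 2]. *)
set g := 8 * s%:R / tau * (1 / (N%:R * h)).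
set T : R := n.+1%:R.
have T1 : 1 <= T by rewrite ler1n.
(* A far node has [(q + 1) theta >= 16 T], which is what [far_factor] needs for this
   [r]; and [n r^2 <= 1/2] keeps the product of all far factors below 2. *)
set r := (4 * T)^-1.
have rT : r * T = 4^-1 by rewrite /r; field; rewrite gt_eqF //; lra.
have r0 : 0 < r by rewrite invr_gt0; lra.
have r4 : r <= 4^-1 by rewrite -rT ler_peMr // ltW.
have g0 : 0 <= g by rewrite !mulr_ge0 ?invr_ge0 ?mulr_ge0 // ltW.
have pi1 : 1 <= pi :> R by apply: le_trans (pi_ge2 R); rewrite ler1n.
have mNR : N%:R <= 2 * (m%:R * s%:R) :> R.
  rewrite -!natrM ler_nat; have := leq_pmull s m0; move: mSs; rewrite mulSn.
  by clear; lia.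
have mNR' : m%:R <= N%:R :> R by rewrite ler_nat.
have z1 k : cmod (expi (x k)) = 1 by exact: cmod_expi.
have r01 : 0 <= r < 1 by rewrite ltW //=; lra.
have near' k : own k -> k != l -> 2 <= g * cmod (expi (x l) ^+ m - expi (x k) ^+ m).
  move=> ok kl; have /andP[wlo whi] := near k ok kl.
  have mw : m%:R * wrap_dist (x l) (x k) <= pi.
    apply: le_trans pi1; apply: le_trans hN.
    by apply: ler_pM => //; apply: le_trans wlo; rewrite mulr_ge0 // ltW.
  apply: le_trans (ler_wpM2l g0 (chord_ge_wrap_dist (xpi l) (xpi k) mw)).
  apply: le_trans (_ : g * (m%:R * (tau * h) / 2) <= _); last first.
    by rewrite ler_wpM2l // ler_wpM2r // ler_wpM2l.
  have -> : g * (m%:R * (tau * h) / 2) = 4 * (m%:R * s%:R) / N%:R.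
    by rewrite /g; field; rewrite !gt_eqF.
  by rewrite ler_pdivlMr //; lra.
have far' k : ~~ own k -> 2 <= r * (q.+1%:R * cmod (expi (x l) - expi (x k))).
  move=> ok; have w := far k ok.
  have mw : 1%:R * wrap_dist (x l) (x k) <= pi by rewrite mul1r wrap_dist_le_pi.
  have := chord_ge_wrap_dist (xpi l) (xpi k) mw; rewrite !expr1 mul1r => ch.
  have qN : N%:R <= q.+1%:R * (4 * T ^+ 2).
    rewrite /T -!natrX -!natrM ler_nat; apply: leq_trans (ltnW mSs) _.
    apply: leq_trans (leq_mul qE (leqW sn)) _.
    by rewrite expnS expn1 !mulnA.
  have h1 : N%:R * theta <= q.+1%:R * (4 * T ^+ 2) * theta by rewrite ler_wpM2r // ltW.
  have h2 : 64 * T ^+ 3 <= q.+1%:R * theta * (4 * T ^+ 2) by lra.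
  have h3 : 16 * T <= q.+1%:R * theta.
    rewrite -(ler_pM2r (_ : 0 < 4 * T ^+ 2)); last by rewrite mulr_gt0 ?exprn_gt0 //; lra.
    by apply: le_trans h2; rewrite le_eqVlt; apply/orP; left; apply/eqP; ring.
  apply: le_trans (_ : r * (q.+1%:R * (theta / 2)) <= _); last first.
    by rewrite ler_wpM2l ?(ltW r0) // ler_wpM2l //; lra.
  have : r * (16 * T) <= r * (q.+1%:R * theta) by rewrite ler_wpM2l // ltW.
  by rewrite [r * (16 * T)]mulrCA rT; lra.
have sizeN : (d + #|[pred k | own k && (k != l)]| * m + n * (2 * q) <= N.+1)%N.
  have e1 : ((s - 1) * m + m = m * s)%N by rewrite -mulSnr subn1 prednK // mulnC.
  have e2 : (n * (2 * q) * 2 <= q * (4 * n.+1))%N by clear; nia.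
  by rewrite cE; move: e1 (leq_trans e2 qm) dm msN; clear; lia.
have [u [uP uB]] := dual_vector z1 ownl g0 r01 near' far' d0 sizeN.
exists u; split => //; apply: le_trans uB _; rewrite cE.
have rr01 : 0 <= r ^+ 2 <= 1 by rewrite sqr_ge0 /= expr_le1 ?ltW //; lra.
have far2 : (1 - r ^+ 2)^-1 ^+ n <= 2.
  have nT : n%:R <= T by rewrite ler_nat.
  have hn : 2^-1 <= (1 - r ^+ 2) ^+ n.
    apply: le_trans (bernoulli_le n rr01).
    have : n%:R * r ^+ 2 <= T * r ^+ 2 by rewrite ler_wpM2r ?sqr_ge0.
    have -> : T * r ^+ 2 = r * 4^-1 by rewrite -rT; ring.
    lra.
  have p0 : 0 < (1 - r ^+ 2) ^+ n by apply: lt_le_trans hn; rewrite invr_gt0.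
  by rewrite exprVn -[leRHS]invrK lef_pV2 ?posrE ?invr_gt0.
rewrite -exprMn -/g.
(* [N + 1 <= (m + 1) s <= 2 d s]. The final constant [8 s] is this [2 s] times the square of the far
   bound 2. *)
have dN : d%:R^-1 <= 2 * s%:R / N.+1%:R :> R.
  rewrite ler_pdivlMr ?ltr0n // mulrC ler_pdivrMr ?ltr0n // -!natrM ler_nat.
  by apply: leq_trans mSs _; apply: leq_trans (leq_mul dE (leqnn s)) _; clear; lia.
have gs0 : 0 <= g ^+ (s - 1) by rewrite exprn_ge0.
have f0 : 0 <= (1 - r ^+ 2)^-1 ^+ n.
  by rewrite exprn_ge0 // invr_ge0 subr_ge0; case/andP: rr01.
have -> : 8 * s%:R / N.+1%:R * (g ^+ (s - 1)) ^+ 2 =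
    2 * s%:R / N.+1%:R * (g ^+ (s - 1) * 2) ^+ 2 :> R by ring.
apply: ler_pM; rewrite ?invr_ge0 ?sqr_ge0 // lerXn2r ?nnegrE ?mulr_ge0 //.
by rewrite ler_wpM2l.
Qed.

End Clusters.

Theorem theorem2p4 (R : realType) :
  exists C16 : nat -> R -> R,
  forall (M : nat) (s : 'I_M -> nat),
    (0 < M)%N -> (forall j, (0 < s j)%N) ->
  exists C14 C15 : R, 0 < C14 /\ 0 < C15 /\
  forall (h tau : 'I_M -> R) (theta : R)
         (x : 'I_(\sum_(j < M) s j) -> R) (C : 'I_M -> set R) (N : nat),
    injective x ->
    clustered_configuration h tau s theta (range x) C ->
    (\sum_(j < M) s j < N)%N ->
    C14 / theta <= N%:R ->
    N%:R <= C15 / \big[Num.max/0]_(j < M) h j ->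
  forall (a0 : 'cV[R[i]]_(\sum_(j < M) s j)) (b0 b : 'cV[R[i]]_(N.+1)),
    b0 = vandermonde N x *m a0 ->
  forall (j : 'I_M) (l : 'I_(\sum_(j < M) s j)),
    C j (x l) ->
    cmod ((least_squares (vandermonde N x) b - a0) l 0)
      <= C16 (s j) (tau j) * (\sum_(j < M) s j)%:R
         * (1 / (N%:R * h j)) ^+ (s j - 1) * norm_infty (b - b0).
Proof.
(* The squared error bound carries the constant [32 s], and [32 s <= 36 s^2 = (6 s)^2]. *)
exists (fun s tau => 6 * s%:R * (8 * s%:R / tau) ^+ (s - 1)) => M s M0 s_gt0.
set n := (\sum_(j < M) s j)%N.
(* With [T = n + 1], [64 T^3] is [4 T^2] times [16 T]: the loss from [N] to [q + 1], and the value
   that [(q + 1) theta] must reach. *)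
exists (64 * n.+1%:R ^+ 3), 1; split; first by rewrite mulr_gt0 ?exprn_gt0 ?ltr0n.
split=> // h tau theta x C N xinj [theta0 xpi [Ccover Cdisj] Cclus Csep] nN thetaN hN.
move=> a0 b0 b b0E j l Cjl; set V := vandermonde N x.
have h0 i : 0 < h i by have [] := Cclus i.
have Nh i : N%:R * h i <= 1.
  have hmax : h i <= \big[Num.max/0]_(j < M) h j by rewrite (bigD1 i) //= le_max lexx.
  apply: le_trans (ler_wpM2l _ hmax) _ => //.
  by rewrite -ler_pdivlMr // (lt_le_trans _ hmax).
have dual i k : C i (x k) -> exists u : 'I_N.+1 -> R[i],
    (forall k', \sum_(p < N.+1) u p * V p k' = (k' == k)%:R) /\
    \sum_(p < N.+1) cmod (u p) ^+ 2 <= 8 * (s i)%:R / N.+1%:R *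
      ((8 * (s i)%:R / tau i) ^+ (s i - 1) * (1 / (N%:R * h i)) ^+ (s i - 1)) ^+ 2.
  move=> Cik; have [_ tau0 _ Ccard Cdist] := Cclus i.
  have [|||||||||||u [uP uB]] := @cluster_dual_vector R n N (s i) x k
      [pred k | `[< C i (x k) >]] (h i) (tau i) theta => //.
  - by move=> k'; apply: xpi; exists k'.
  - exact/asboolP.
  - by apply: card_preimage_cluster => // y Cy; rewrite -Ccover; exists i.
  - move=> k' /asboolP Ck' k'k; apply: Cdist => //.
    by move=> /xinj e; move: k'k; rewrite e eqxx.
  - by move=> k' /asboolP Ck'; apply: Csep Cik _.
  - by rewrite -ler_pdivrMr.
  exists u; split => // k'; rewrite -uP; apply: eq_bigr => p _.
  by rewrite mxE expiX.
(* Full column rank comes from the same dual vectors: each component of [c] is a pairing with [V c].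
   Hence [dual] is stated for every cluster and node. *)
have Vinj (c : 'cV[R[i]]_n) : V *m c = 0 -> c = 0.
  move=> Vc; apply/matrixP => k o; rewrite ord1 [RHS]mxE {o}.
  have [i _ Cik] : (\bigcup_i C i) (x k) by rewrite Ccover; exists k.
  have [u [uP _]] := dual i k Cik.
  have : \sum_(p < N.+1) u p * (V *m c) p 0 = 0.
    by rewrite big1 // => p _; rewrite Vc mxE mulr0.
  under eq_bigr do rewrite mxE mulr_sumr.
  rewrite exchange_big /=; under eq_bigr do under eq_bigr do rewrite mulrA.
  under eq_bigr do rewrite -mulr_suml uP.
  rewrite (bigD1 k) //= eqxx mul1r big1 ?addr0 // => k' k'k.
  by rewrite (negPf k'k) mul0r.
have [u [uP uB]] := dual j l Cjl.
have := least_squares_dual_bound (b := b) a0 (least_squaresP b Vinj) uP.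
rewrite -b0E; set E := norm_infty _ => bound.
have E0 : 0 <= E by exact: norm_infty_ge0.
have tau0 : 0 < tau j by have [] := Cclus j.
set G := (8 * (s j)%:R / tau j) ^+ (s j - 1); set H := (1 / _) ^+ _ in uB *.
have G0 : 0 <= G by rewrite exprn_ge0 // divr_ge0 ?mulr_ge0 // ltW.
have H0 : 0 <= H by rewrite exprn_ge0 // divr_ge0 // mulr_ge0 // ltW.
have s1 : 1 <= (s j)%:R :> R by rewrite ler1n.
have n1 : 1 <= n%:R :> R by rewrite ler1n (leq_ltn_trans _ (ltn_ord l)).
apply: le_trans (_ : 6 * (s j)%:R * G * H * E <= _); last first.
  have : 0 <= 6 * (s j)%:R * G * H * E by rewrite !mulr_ge0.
  move=> p0; have := ler_wpM2l p0 n1; rewrite mulr1 => /le_trans; apply.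
  by rewrite le_eqVlt; apply/orP; left; apply/eqP; ring.
rewrite -(ler_pXn2r (n := 2)) ?nnegrE ?cmod_ge0 ?mulr_ge0 //.
apply: le_trans bound _.
have N1 : 0 < N.+1%:R :> R by rewrite ltr0n.
have coef0 : 0 <= 4 * N.+1%:R * E ^+ 2 by rewrite !mulr_ge0 ?sqr_ge0.
apply: le_trans (ler_wpM2l coef0 uB) _.
(* The [N + 1] lost in passing from the sup norm to the 2-norm cancels against the [1 / (N + 1)]
   gained from the Dirichlet kernel. *)
have -> : 4 * N.+1%:R * E ^+ 2 * (8 * (s j)%:R / N.+1%:R * (G * H) ^+ 2) =
    32 * (s j)%:R * (G * H * E) ^+ 2 by field; rewrite gt_eqF.
have -> : (6 * (s j)%:R * G * H * E) ^+ 2 =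
    36 * (s j)%:R ^+ 2 * (G * H * E) ^+ 2 by ring.
apply: ler_wpM2r; first exact: sqr_ge0.
have : (s j)%:R * 1 <= (s j)%:R * (s j)%:R :> R by rewrite ler_wpM2l.
by rewrite expr2; lra.
Qed.
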